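(* For every real matrix $A \in \mathbb{R}^{m\times n}$ and every integer $c \ge 2$, \[ \operatorname{herwdisc}(A,2) \le c\, \operatorname{herdisc}(A,c). \]
   Context: For $A=(a_{ij}) \in \mathbb{R}^{m\times n}$, an integer $c \ge 2$ and $p:[n]\to[c]$, let $\operatorname{disc}(A,p,c) := \max_{d\in[c],\, i\in[m]} \left| \sum_{j \in p^{-1}(d)} a_{ij} - \frac{1}{c}\sum_{j\in[n]} a_{ij}\right|$, $\operatorname{disc}(A,c) := \min_{p:[n]\to[c]} \operatorname{disc}(A,p,c)$, and $\operatorname{herdisc}(A,c) := \max_{A_0} \operatorname{disc}(A_0,c)$ over all submatrices $A_0$ of $A$ (obtained by deleting some rows and columns). For maps $p,q:[n]\to[0,1]$ (floating colorings) let $d_A(p,q) := \max_{i\in[m]} \left|\sum_{j\in[n]} a_{ij}(p(j)-q(j))\right|$. For $z\in[0,1]$ let $\mathbf{1}_n$ denote the constant map $[n]\to\{1\}$ and define $\operatorname{wdisc}(A,z) := \min_{q:[n]\to\{0,1\}} d_A(z\mathbf{1}_n, q)$, $\operatorname{wdisc}(A,2) := \max_{z\in[0,1]} \operatorname{wdisc}(A,z)$, and $\operatorname{herwdisc}(A,2) := \max_{A_0} \operatorname{wdisc}(A_0,2)$ over all submatrices $A_0$ of $A$. *)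

(* Defs.v *)
From mathcomp Require Import all_boot all_order all_algebra.
From mathcomp Require Import all_classical all_reals all_analysis.
Import Order.TTheory GRing.Theory Num.Theory numFieldNormedType.Exports.

Set Implicit Arguments.
Unset Strict Implicit.
Unset Printing Implicit Defensive.

Local Open Scope classical_set_scope.
Local Open Scope ring_scope.

(* The maxima of nonnegative quantities over finite index types are
   [\big[Num.max/0]], so an empty maximum (no rows, or no columns) is 0.
   Minima over colorings are [inf] of nonempty finite sets, and the maximum over
   [z \in [0, 1]] is a [sup]; the lemmas at the end show that these are
   attained. *)

Section Discrepancy.
Variable R : realType.

Definition disc_coloring (m n : nat) (A : 'M[R]_(m, n)) (c : nat)
    (p : {ffun 'I_n -> 'I_c}) : R :=
  \big[Num.max/0]_(d < c) \big[Num.max/0]_(i < m)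
    `| \sum_(j < n | p j == d) A i j - c%:R^-1 * \sum_(j < n) A i j |.

Definition disc (m n : nat) (A : 'M[R]_(m, n)) (c : nat) : R :=
  inf [set disc_coloring A p | p in [set: {ffun 'I_n -> 'I_c}]].

(* The submatrix of [A] keeping the rows in [I] and the columns in [J], in
   increasing order of their indices. *)
Definition submatrix (m n : nat) (A : 'M[R]_(m, n))
    (I : {set 'I_m}) (J : {set 'I_n}) : 'M[R]_(#|I|, #|J|) :=
  mxsub (fun i : 'I_#|I| => enum_val i) (fun j : 'I_#|J| => enum_val j) A.

Definition herdisc (m n : nat) (A : 'M[R]_(m, n)) (c : nat) : R :=
  \big[Num.max/0]_(I : {set 'I_m}) \big[Num.max/0]_(J : {set 'I_n})
    disc (submatrix A I J) c.

(* Floating colorings are functions ['I_n -> R]; the range condition [0, 1] is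
   imposed where they are quantified over. *)
Definition coloring_dist (m n : nat) (A : 'M[R]_(m, n)) (p q : 'I_n -> R) : R :=
  \big[Num.max/0]_(i < m) `| \sum_(j < n) A i j * (p j - q j) |.

(* A {0, 1}-coloring is boolean-valued, [(q j)%:R] being its value in [R]. *)
Definition wdisc (m n : nat) (A : 'M[R]_(m, n)) (z : R) : R :=
  inf [set coloring_dist A (fun=> z) (fun j => (q j)%:R)
      | q in [set: {ffun 'I_n -> bool}]].

Definition wdisc2 (m n : nat) (A : 'M[R]_(m, n)) : R :=
  sup [set wdisc A z | z in `[0, 1]].

Definition herwdisc2 (m n : nat) (A : 'M[R]_(m, n)) : R :=
  \big[Num.max/0]_(I : {set 'I_m}) \big[Num.max/0]_(J : {set 'I_n})
    wdisc2 (submatrix A I J).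

Lemma inf_finite_attained (T : finType) (f : T -> R) (t0 : T) :
  exists2 t, inf [set f x | x in [set: T]] = f t & forall x, f t <= f x.
Proof.
pose t := [arg min_(x < t0) f x]%O.
have ft x : f t <= f x by rewrite /t; case: arg_minP => // y _; exact.
exists t => //; apply/eqP; rewrite eq_le; apply/andP; split.
  apply: ge_inf; last by exists t.
  by exists (f t) => _ [x _ <-].
apply: lb_le_inf; first by exists (f t), t.
by move=> _ [x _ <-].
Qed.

Lemma disc_attained (m n : nat) (A : 'M[R]_(m, n)) (c : nat) : (0 < c)%N ->
  exists2 p : {ffun 'I_n -> 'I_c}, disc A c = disc_coloring A p
    & forall p' : {ffun 'I_n -> 'I_c}, disc_coloring A p <= disc_coloring A p'.
Proof. by move=> c0; apply: inf_finite_attained; exact: [ffun=> Ordinal c0]. Qed.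

Lemma wdisc_attained (m n : nat) (A : 'M[R]_(m, n)) (z : R) :
  exists2 q : {ffun 'I_n -> bool},
    wdisc A z = coloring_dist A (fun=> z) (fun j => (q j)%:R)
    & forall q' : {ffun 'I_n -> bool}, wdisc A z <=
        coloring_dist A (fun=> z) (fun j => (q' j)%:R).
Proof.
have [q e qmin] := inf_finite_attained
  (fun q : {ffun 'I_n -> bool} => coloring_dist A (fun=> z) (fun j => (q j)%:R))
  [ffun=> false].
by exists q => // q'; rewrite /wdisc e.
Qed.

Lemma wdisc_lipschitz (m n : nat) (A : 'M[R]_(m, n)) (y z : R) :
  wdisc A y <= wdisc A z
    + (\big[Num.max/0]_(i < m) `| \sum_(j < n) A i j |) * `|y - z|.
Proof.
have [q -> _] := wdisc_attained A z.
have [_ _ /(_ q) h] := wdisc_attained A y; apply: (le_trans h).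
rewrite {1}/coloring_dist; apply: bigmax_le.
  by rewrite addr_ge0 ?mulr_ge0// bigmax_ge_id.
move=> i _.
have -> : \sum_(j < n) A i j * (y - (q j)%:R) =
    \sum_(j < n) A i j * (z - (q j)%:R) + (\sum_(j < n) A i j) * (y - z).
  rewrite mulr_suml -big_split/=; apply: eq_bigr => j _.
  by rewrite -mulrDr; congr (_ * _); rewrite [RHS]addrC addrA subrK.
apply: (le_trans (ler_normD _ _)); rewrite normrM lerD//.
  exact: (le_bigmax _ (fun i => `|\sum_(j < n) A i j * (z - (q j)%:R)|)).
rewrite ler_wpM2r//.
exact: (le_bigmax _ (fun i => `|\sum_(j < n) A i j|)).
Qed.

Lemma wdisc2_attained (m n : nat) (A : 'M[R]_(m, n)) :
  exists2 z, 0 <= z <= 1 & wdisc2 A = wdisc A z /\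
    forall y, 0 <= y <= 1 -> wdisc A y <= wdisc A z.
Proof.
have cw : continuous (wdisc A).
  set L := \big[Num.max/0]_(i < m) `| \sum_(j < n) A i j |.
  have L0 : 0 <= L by exact: bigmax_ge_id.
  move=> x; apply/cvgrPdist_le => /= e e0; near=> t.
  have xt : L * `|x - t| <= e.
    apply: (@le_trans _ _ ((L + 1) * `|x - t|)).
      by rewrite ler_wpM2r// lerDl.
    rewrite -ler_pdivlMl ?ltr_wpDl//.
    near: t; apply: cvgr_dist_le; first exact: cvg_id.
    by rewrite mulr_gt0// invr_gt0 ltr_wpDl.
  rewrite ler_distl; apply/andP; split.
    rewrite lerBlDr (le_trans (wdisc_lipschitz A t x))//.
    by rewrite lerD2l distrC.
  by rewrite (le_trans (wdisc_lipschitz A x t))// lerD2l.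
have [] := @EVT_max R (wdisc A) 0 1 ler01; first exact: continuous_subspaceT.
move=> z; rewrite in_itv/= => z01 zmax; exists z => //.
have zm y : 0 <= y <= 1 -> wdisc A y <= wdisc A z.
  by move=> y01; apply: zmax; rewrite in_itv.
split=> //; apply/eqP; rewrite eq_le; apply/andP; split.
  apply: ge_sup; first by exists (wdisc A z), z => //=; rewrite in_itv.
  by move=> _ [y /= + <-]; rewrite in_itv/=; exact: zm.
apply: ub_le_sup; last by exists z => //=; rewrite in_itv.
by exists (wdisc A z) => _ [y /= + <-]; rewrite in_itv/=; exact: zm.
Unshelve. all: by end_near.
Qed.

End Discrepancy.

(* Main.v *)
Require Import Defs.
From mathcomp Require Import all_boot all_order all_algebra.
From mathcomp Require Import all_classical all_reals all_analysis.
From mathcomp Require Import ring.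
Import Order.TTheory GRing.Theory Num.Theory numFieldNormedType.Exports.
Local Open Scope ring_scope.

Set Implicit Arguments.
Unset Strict Implicit.
Unset Printing Implicit Defensive.

(* Write z in base c and round off its last digit repeatedly.  When all values
   lie in {x, x + 1} (in units of c^-k) and x = c y + d, a c-coloring of the
   columns of value x, with d color classes rounded up, and a c-coloring of the
   columns of value x + 1, with c - d - 1 color classes rounded down, bring all
   values to {c y, c (y + 1)}.  This costs at most
   (d + (c - d - 1)) herdisc(A, c) = (c - 1) herdisc(A, c)
   in units of c^-(k-1), and the geometric series sums to c herdisc(A, c).  An
   arbitrary z is a limit of numbers with finite expansion. *)

Lemma le_of_eq (disp : Order.disp_t) (T : porderType disp) (x y : T) :
  x = y -> (x <= y)%O.
Proof. by move=> ->. Qed.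

Lemma herdisc_ge0 (R : realType) (m n : nat) (A : 'M[R]_(m, n)) (c : nat) :
  0 <= herdisc A c.
Proof. exact: bigmax_ge_id. Qed.

Lemma disc_le_herdisc (R : realType) (m n : nat) (A : 'M[R]_(m, n)) (c : nat)
    (I : {set 'I_m}) (J : {set 'I_n}) :
  disc (submatrix A I J) c <= herdisc A c.
Proof.
rewrite /herdisc.
apply: le_trans (le_bigmax _ (fun I => \big[Num.max/0]_(J : {set 'I_n})
    disc (submatrix A I J) c) I).
exact: (le_bigmax _ (fun J => disc (submatrix A I J) c) J).
Qed.

(** An optimal coloring of the submatrix with all rows and the columns in [J], carried back to the
    column indices of [A]. *)
Lemma herdisc_coloring (R : realType) (m n : nat) (A : 'M[R]_(m, n)) (c : nat)
    (J : {set 'I_n}) : (0 < c)%N ->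
  exists p : 'I_n -> 'I_c, forall i d,
    `|\sum_(j in J | p j == d) A i j - c%:R^-1 * \sum_(j in J) A i j|
      <= herdisc A c.
Proof.
move=> c0; have [p ep _] := disc_attained (submatrix A [set: 'I_m] J) c0.
(* Columns outside [J] get color 0 by default; the sums below never see them. *)
pose f j := oapp (fun k => p k) (Ordinal c0) [pick k | enum_val k == j :> 'I_n].
have fE k : f (enum_val k) = p k.
  rewrite /f; case: pickP => [k' /eqP /enum_val_inj -> //|/(_ k)].
  by rewrite eqxx.
exists f => i d; apply: le_trans (disc_le_herdisc A c [set: 'I_m] J).
rewrite ep /disc_coloring.
have iT : i \in [set: 'I_m] by rewrite inE.
set F := (X in _ <= \big[_/_]_d X d).
apply: le_trans (le_bigmax _ F d); rewrite /F.
set G := (X in _ <= \big[_/_]_i X i).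
apply: le_trans (le_bigmax _ G (enum_rank_in iT i)); rewrite /G.
apply: le_of_eq; congr (`|_ - _ * _|).
  rewrite big_enum_val_cond.
  by apply: eq_big => [k|k _]; rewrite ?fE// mxE enum_rankK_in.
by rewrite big_enum_val; apply: eq_bigr => k _; rewrite mxE enum_rankK_in.
Qed.

(** Uniting the color classes in [D] adds up their errors. The union rounds the constant value
    [#|D| / c] on [J] to 0 or 1. *)
Lemma herdisc_coloring_classes (R : realType) (m n : nat) (A : 'M[R]_(m, n))
    (c : nat) (J : {set 'I_n}) (D : {set 'I_c}) : (0 < c)%N ->
  exists p : 'I_n -> 'I_c, forall i,
    `|\sum_(j in J) A i j * ((p j \in D)%:R - #|D|%:R / c%:R)|
      <= #|D|%:R * herdisc A c.
Proof.
move=> c0; have [p pP] := herdisc_coloring A J c0; exists p => i.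
have -> : \sum_(j in J) A i j * ((p j \in D)%:R - #|D|%:R / c%:R) =
    \sum_(d in D) (\sum_(j in J | p j == d) A i j
                   - c%:R^-1 * \sum_(j in J) A i j).
  rewrite sumrB sumr_const.
  under eq_bigr do rewrite mulrBr.
  rewrite sumrB -mulr_suml; congr (_ - _); last by rewrite -mulr_natl; ring.
  under [RHS]eq_bigr do rewrite big_mkcondr /=.
  rewrite exchange_big /=; apply: eq_bigr => j _.
  case: (boolP (p j \in D)) => pD.
    rewrite (bigD1 (p j)) //= eqxx big1 ?addr0 ?mulr1// => d /andP[_].
    by rewrite eq_sym => /negPf ->.
  rewrite big1 ?mulr0// => d dD; case: eqP => // e.
  by rewrite e dD in pD.
apply: le_trans (ler_norm_sum _ _ _) _.
by rewrite mulr_natl -sumr_const; apply: ler_sum => d _; exact: pP.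
Qed.

(** [S] marks the columns of value [(d + 1) / c], the others having value [d / c]; [T] marks those
    rounded to 1. The two kinds of columns are colored independently. *)
Lemma round_digit (R : realType) (m n : nat) (A : 'M[R]_(m, n)) (c d : nat)
    (J S : {set 'I_n}) : (d < c)%N ->
  exists T : {set 'I_n}, forall i,
    `|\sum_(j in J) A i j * ((d + (j \in S))%:R / c%:R - (j \in T)%:R)|
      <= c.-1%:R * herdisc A c.
Proof.
move=> dc; have c0 : (0 < c)%N by apply: leq_ltn_trans dc.
have cN0 : c%:R != 0 :> R by rewrite pnatr_eq0 -lt0n.
pose D := [set e : 'I_c | (e < d)%N]; pose E := [set e : 'I_c | (d < e)%N].
have cD : #|D| = d.
  rewrite cardsE -sum1_card (big_ord_narrow (ltnW dc)) /=.
  by rewrite sum1_card card_ord.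
have cE : #|E| = (c - d.+1)%N.
  have -> : E = ~: [set e : 'I_c | (e < d.+1)%N].
    by apply/setP => e; rewrite !inE -leqNgt.
  rewrite cardsCs finset.setCK card_ord cardsE -sum1_card.
  rewrite (big_ord_narrow dc) /=.
  by rewrite sum1_card card_ord.
have [p pP] := herdisc_coloring_classes A (J :\: S) D c0.
have [q qP] := herdisc_coloring_classes A (J :&: S) E c0.
(* In [S] the colors in [E] are rounded down to 0; outside [S] those in [D] are rounded up to 1. *)
exists [set j | if j \in S then q j \notin E else p j \in D] => i.
rewrite (big_setID S) /=.
have -> : c.-1%:R = (#|E| + #|D|)%:R :> R.
  by rewrite cD cE subnS predn_sub subnK// -ltnS prednK.
rewrite natrD mulrDl; apply: le_trans (ler_normD _ _) (lerD _ _).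
  (* Since [(d + 1) / c = 1 - #|E| / c], rounding down on [E] has the error of [E] itself, with the
     same sign. *)
  apply: le_trans (qP i); apply: le_of_eq.
  congr `|_|; apply: eq_bigr => j; rewrite inE => /andP[_ jS].
  rewrite !inE jS cE natrB// addn1; congr (_ * _).
  by case: (d < q j)%N => /=; field.
rewrite -normrN; apply: le_trans (pP i).
apply: le_of_eq; rewrite -sumrN; congr `|_|.
apply: eq_bigr => j; rewrite inE => /andP[/negPf jS _].
by rewrite !inE jS cD addn0 -mulrN opprB.
Qed.

(** The set [S] of carries makes the induction on [k] work: rounding the last digit yields a number
    with one digit less and a new set of carries. The bound is the sum of
    [c^-l * (c - 1) * herdisc A c] over [l < k]. *)
Lemma round_digits (R : realType) (m n : nat) (A : 'M[R]_(m, n)) (c k x : nat)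
    (J S : {set 'I_n}) : (0 < c)%N -> (x < c ^ k)%N ->
  exists T : {set 'I_n}, forall i,
    `|\sum_(j in J) A i j * ((x + (j \in S))%:R / c%:R ^+ k - (j \in T)%:R)|
      <= c%:R * herdisc A c * (1 - c%:R ^- k).
Proof.
move=> c0; have cN0 : c%:R != 0 :> R by rewrite pnatr_eq0 -lt0n.
elim: k x S => [|k IH] x S.
  (* With no digits left, [x = 0] and the values are already the indicator of [S]. *)
  rewrite expn0 ltnS leqn0 => /eqP ->; exists S => i.
  rewrite big1 ?normr0 ?expr0 ?invr1 ?subrr ?mulr0// => j _.
  by rewrite add0n mulr1 subrr mulr0.
move=> xc; have [S' S'P] := round_digit A J S (ltn_pmod x c0).
have yc : (x %/ c < c ^ k)%N by rewrite ltn_divLR// -expnSr.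
have [T TP] := IH _ S' yc; exists T => i.
(* Telescoping through the values [(x %/ c + (j \in S')) / c^k] reached after one rounding. *)
have -> : \sum_(j in J)
      A i j * ((x + (j \in S))%:R / c%:R ^+ k.+1 - (j \in T)%:R) =
    c%:R ^- k * (\sum_(j in J)
      A i j * ((x %% c + (j \in S))%:R / c%:R - (j \in S')%:R)) +
    \sum_(j in J)
      A i j * ((x %/ c + (j \in S'))%:R / c%:R ^+ k - (j \in T)%:R).
  rewrite mulr_sumr -big_split /=; apply: eq_bigr => j _.
  rewrite {1}(divn_eq x c) !natrD natrM exprS.
  by field; rewrite expf_neq0 ?cN0.
apply: le_trans (ler_normD _ _) _.
have ck0 : 0 <= c%:R ^- k :> R by rewrite invr_ge0 exprn_ge0.
have -> : c%:R * herdisc A c * (1 - c%:R ^- k.+1) =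
    c%:R ^- k * (c.-1%:R * herdisc A c)
    + c%:R * herdisc A c * (1 - c%:R ^- k).
  rewrite -subn1 natrB// exprS.
  by field; rewrite expf_neq0 ?cN0.
by rewrite normrM ger0_norm// lerD// ler_wpM2l.
Qed.

Lemma wdisc_submatrix_digits (R : realType) (m n : nat) (A : 'M[R]_(m, n))
    (c k x : nat) (I : {set 'I_m}) (J : {set 'I_n}) :
  (0 < c)%N -> (x < c ^ k)%N ->
  wdisc (submatrix A I J) (x%:R / c%:R ^+ k) <= c%:R * herdisc A c.
Proof.
(* No carries at the start: every column has the value [x / c^k]. *)
move=> c0 xc; have [T TP] := round_digits A J finset.set0 c0 xc.
have h0 := herdisc_ge0 A c.
have [_ _ /(_ [ffun j => enum_val j \in T]) le_q] :=
  wdisc_attained (submatrix A I J) (x%:R / c%:R ^+ k).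
apply: le_trans le_q _; apply: bigmax_le => [|i _]; first by rewrite mulr_ge0.
apply: (@le_trans _ _ (c%:R * herdisc A c * (1 - c%:R ^- k))).
  apply: le_trans (TP (enum_val i)); rewrite [in leRHS]big_enum_val.
  apply: le_of_eq.
  by congr `|_|; apply: eq_bigr => j _; rewrite mxE ffunE inE addn0.
by rewrite ler_piMr ?mulr_ge0// gerBl invr_ge0 exprn_ge0.
Qed.

Lemma grid_approx (R : realType) (N : nat) (z : R) :
  (0 < N)%N -> 0 <= z <= 1 ->
  exists2 x, (x < N)%N & `|z - x%:R / N%:R| <= N%:R^-1.
Proof.
move=> N0 /andP[z0 z1].
have NR : 0 < N%:R :> R by rewrite ltr0n.
have zN0 : 0 <= z * N%:R by rewrite mulr_ge0.
have close (x : nat) : x%:R <= z * N%:R <= x.+1%:R ->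
    `|z - x%:R / N%:R| <= N%:R^-1.
  move=> /andP[lx ux].
  rewrite ger0_norm ?subr_ge0 ?ler_pdivrMr//.
  by rewrite lerBlDl -[X in _ + X]mul1r -mulrDl natr1 ler_pdivlMr.
move: z1; rewrite le_eqVlt => /orP[/eqP ->|z1].
  (* At [z = 1] rounding down would give [x = N], which is out of range, so the previous grid point
     is taken. *)
  exists N.-1; first by rewrite prednK.
  rewrite -[X in `|X - _|](divff (lt0r_neq0 NR)) -mulrBl -natrB ?leq_pred//.
  by rewrite -{1}(prednK N0) subSnn mul1r ger0_norm// invr_ge0 ltW.
have /andP[lx ux] := Num.Theory.truncn_itv zN0.
exists (Num.truncn (z * N%:R)); last by apply: close; rewrite lx ltW.
by rewrite -(ltr_nat R) (le_lt_trans lx)// gtr_pMl.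
Qed.

Lemma wdisc_submatrix_le (R : realType) (m n : nat) (A : 'M[R]_(m, n)) (c : nat)
    (I : {set 'I_m}) (J : {set 'I_n}) (z : R) :
  (2 <= c)%N -> 0 <= z <= 1 ->
  wdisc (submatrix A I J) z <= c%:R * herdisc A c.
Proof.
move=> c2 z01; have c0 : (0 < c)%N by apply: ltnW.
apply/ler_addgt0Pr => e e0; set B := submatrix A I J.
pose L := \big[Num.max/0]_i `|\sum_j B i j|.
have L0 : 0 <= L by exact: bigmax_ge_id.
(* As [L / e < k < c^k], moving [z] to the grid of mesh [c^-k] changes [wdisc] by at most
   [L * c^-k <= e]. *)
pose k := (Num.truncn (L / e)).+1.
have Lk : L / e <= (c ^ k)%:R.
  apply: le_trans (ltW (truncnS_gt _)) _.
  by rewrite ler_nat ltnW// ltn_expl.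
have [x xk zx] : exists2 x, (x < c ^ k)%N &
    `|z - x%:R / (c ^ k)%:R| <= (c ^ k)%:R^-1.
  by apply: grid_approx; rewrite ?expn_gt0 ?c0.
apply: le_trans (wdisc_lipschitz B z (x%:R / c%:R ^+ k)) _.
apply: lerD; first exact: wdisc_submatrix_digits.
rewrite -/L -natrX; apply: le_trans (ler_wpM2l L0 zx) _.
by rewrite ler_pdivrMr ?ltr0n ?expn_gt0 ?c0// mulrC -ler_pdivrMr.
Qed.

Theorem theorem8 (R : realType) (m n : nat) (A : 'M[R]_(m, n)) (c : nat)
    (hc : (2 <= c)%N) :
  herwdisc2 A <= c%:R * herdisc A c.
Proof.
have h0 : 0 <= c%:R * herdisc A c by rewrite mulr_ge0 ?herdisc_ge0.
apply: bigmax_le => // I _; apply: bigmax_le => // J _.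
have [z z01 [-> _]] := wdisc2_attained (submatrix A I J).
exact: wdisc_submatrix_le.
Qed.
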